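(* For $A\in\mathbb{R}$ let $$H^{(3)}(A)=\begin{pmatrix} -iA&-1&0\\ -1&0&-1\\ 0&-1&iA\end{pmatrix}\in\mathbb{C}^{3\times 3}.$$ Then $H^{(3)}(A)$ possesses two exceptional points of order three (EP3), at $A=\sqrt{2}$ and at $A=-\sqrt{2}$. That is, for each of these two values of $A$ there exists an invertible matrix $Q\in\mathbb{C}^{3\times 3}$ such that $$Q^{-1}\,H^{(3)}(A)\,Q=J^{(3)},\qquad J^{(3)}=\begin{pmatrix}0&1&0\\0&0&1\\0&0&0\end{pmatrix}.$$
   Context: An exceptional point of maximal order $N$ (EPN) of a parameter-dependent $N\times N$ matrix Hamiltonian $H$ is a value of the parameters at which $H$ becomes non-diagonalizable and is similar to the single $N\times N$ nilpotent Jordan block $J^{(N)}$ (zeros on the diagonal, ones on the first superdiagonal), so that all $N$ eigenvalues merge at $E=0$ and all eigenvectors coalesce. The similarity matrix $Q$ is called the transition matrix. *)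

(* Defs.v *)
From mathcomp Require Import all_boot all_order all_algebra.
From mathcomp Require Export reals complex.

Set Implicit Arguments.
Unset Strict Implicit.
Unset Printing Implicit Defensive.

Import GRing.Theory Num.Theory.
Local Open Scope ring_scope.
Local Open Scope complex_scope.

Definition jordan_nilp (F : fieldType) (N : nat) : 'M[F]_N :=
  \matrix_(i < N, j < N) ((j : nat) == i.+1)%:R.

(* [diagonalizable] uses P *m A *m P^-1; since P ranges over all invertible
   matrices, this is the usual notion. *)
Definition is_EP (F : fieldType) (T : Type) (N : nat)
    (H : T -> 'M[F]_N) (a : T) : Prop :=
  ~ diagonalizable (H a) /\
  exists Q : 'M[F]_N,
    Q \in unitmx /\ invmx Q *m H a *m Q = jordan_nilp F N.

Definition H3 (R : realType) (A : R) : 'M[R[i]]_3 :=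
  \matrix_(i < 3, j < 3)
    nth 0 (nth [::]
      [:: [:: - ('i * A%:C);  -1;   0         ];
          [:: -1;              0;  -1         ];
          [:: 0;              -1;   'i * A%:C ]] i) j.

(* Main.v *)
(* Put c = i A. When A^2 = 2 we have c^2 = -2, hence H^3 = 0, while H^2 e <> 0 for
   the first basis vector e; so H^2 e, H e, e is a Jordan chain of length three.
   A nilpotent diagonalizable matrix vanishes, so H is not diagonalizable. *)
Require Import Defs.
From mathcomp Require Import all_boot all_order all_algebra.
From mathcomp Require Import reals complex.
From mathcomp Require Import ring.
Import Order.TTheory GRing.Theory Num.Theory.
Local Open Scope ring_scope.

Lemma diag_mx_exp (F : fieldType) (n k : nat) (d : 'rV[F]_n.+1) :
  diag_mx d ^+ k = diag_mx (\row_j d 0 j ^+ k).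
Proof.
elim: k => [|k IHk].
  by apply/matrixP => i j; rewrite expr0 !mxE.
rewrite exprS IHk [_ * _]mul_diag_mx.
by apply/matrixP => i j; rewrite !mxE exprS mulrnAr.
Qed.

(** In an eigenbasis the [k]-th power is the diagonal matrix of the [d 0 j ^+ k], and a field has no
    nonzero nilpotents. The case [k = 0] is vacuous. *)
Lemma diagonalizable_nilpotent (F : fieldType) (n k : nat) (A : 'M[F]_n.+1) :
  diagonalizable A -> A ^+ k = 0 -> A = 0.
Proof.
case=> P Punit /(similar_diagLR Punit)[d ->].
rewrite (conjVmx _ Punit).
have -> : (invmx P *m diag_mx d *m P) ^+ k = invmx P *m diag_mx d ^+ k *m P.
  elim: k => [|k IHk]; first by rewrite !expr0 [_ *m 1]mulmx1 mulVmx.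
  by rewrite !exprS IHk -!mulmxE !mulmxA mulmxK.
move=> /(congr1 (fun B => P *m B *m invmx P)).
rewrite !mulmxA mulmxV // mul1mx mulmxK // mulmx0 mul0mx diag_mx_exp => dk0.
suff -> : d = 0 by rewrite raddf0 mulmx0 mul0mx.
apply/rowP => j; have /eqP := congr1 (fun B : 'M_n.+1 => B j j) dk0.
by rewrite !mxE eqxx mulr1n expf_eq0 => /andP[_ /eqP].
Qed.

(** The argument uses only the square of [A], so it covers both signs of the root. *)
Lemma is_EP_H3 (R : realType) (A : R) : A ^+ 2 = 2 -> is_EP (@H3 R) A.
Proof.
move=> A2.
pose c : R[i] := 'i%C * (A%:C)%C.
have c2 : c * c = -2.
  by rewrite -expr2 exprMn sqr_i -rmorphXn A2 mulN1r rmorph_nat.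
have HE : H3 A = \matrix_(i < 3, j < 3)
    nth 0 (nth [::] [:: [:: - c; -1; 0]; [:: -1; 0; -1]; [:: 0; -1; c]] i) j.
  by [].
(* The columns of [Q] are the Jordan chain [H^2 e, H e, e] of the first basis
   vector [e]; [Qi] is its inverse. *)
pose Q : 'M[R[i]]_3 := \matrix_(i < 3, j < 3)
  nth 0 (nth [::] [:: [:: -1; - c; 1]; [:: c; -1; 0]; [:: 1; 0; 0]] i) j.
pose Qi : 'M[R[i]]_3 := \matrix_(i < 3, j < 3)
  nth 0 (nth [::] [:: [:: 0; 0; 1]; [:: 0; -1; c]; [:: 1; - c; -1]] i) j.
have QiQ : Qi *m Q = 1%:M.
  apply/matrixP => -[[|[|[|//]]] ?] -[[|[|[|//]]] ?];
    rewrite !mxE !big_ord_recl big_ord0 !mxE /=; ring: c2.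
(* This intertwining form keeps [invmx Q] out of the entrywise check, whose entries are polynomials
   in [c] reduced by [c2]. *)
have HQ : H3 A *m Q = Q *m jordan_nilp R[i] 3.
  rewrite HE; apply/matrixP => -[[|[|[|//]]] ?] -[[|[|[|//]]] ?];
    rewrite !mxE !big_ord_recl !big_ord0 !mxE /=; ring: c2.
have [_ Qunit] := mulmx1_unit QiQ.
have HJ : invmx Q *m H3 A *m Q = jordan_nilp R[i] 3.
  by rewrite -mulmxA HQ mulKmx.
split; last by exists Q.
have H30 : H3 A ^+ 3 = 0.
  rewrite HE; apply/matrixP => -[[|[|[|//]]] ?] -[[|[|[|//]]] ?];
    rewrite !exprS expr0 mulr1 -!mulmxE !mxE !big_ord_recl !big_ord0 !mxE /=;
    rewrite !big_ord_recl !big_ord0 !mxE /=; ring: c2.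
(* The entry at [(0, 1)] is -1, so the matrix is not zero. *)
move=> /diagonalizable_nilpotent /(_ H30) /matrixP /(_ 0 1) /eqP.
by rewrite !mxE /= oppr_eq0 oner_eq0.
Qed.

Theorem lemma1 (R : realType) :
  [/\ is_EP (@H3 R) (Num.sqrt 2),
      is_EP (@H3 R) (- Num.sqrt 2)
    & Num.sqrt 2 != - Num.sqrt 2 :> R].
Proof.
split.
- by apply: is_EP_H3; rewrite sqr_sqrtr.
- by apply: is_EP_H3; rewrite sqrrN sqr_sqrtr.
(* Equality would force [Num.sqrt 2] to vanish, that is 2 <= 0. *)
- by rewrite eq_sym eqNr sqrtr_eq0 -ltNge.
Qed.
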